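(* Let $D$ be an affine diagram of period $n$. Then $D$ is an affine permutation diagram, i.e. $D=D(w)$ for some $w\in\widetilde{\Sigma}_n$, if and only if $D$ is North-West and admits a content map.
   Context: Let $n\ge1$. $\widetilde{\Sigma}_n$ is the group of bijections $w:\mathbb{Z}\to\mathbb{Z}$ with $w(i+n)=w(i)+n$ and $\sum_{i=1}^nw(i)=n(n+1)/2$, and $D(w)=\{(i,w(j)) : i<j,\ w(i)>w(j)\}\subseteq\mathbb{Z}\times\mathbb{Z}$. Coordinates on $\mathbb{Z}\times\mathbb{Z}$ are matrix-like: the first coordinate is the row index, increasing southward, and the second is the column index, increasing eastward. An affine diagram of period $n$ is a subset $D\subseteq\mathbb{Z}\times\mathbb{Z}$ (elements are called boxes) with finitely many boxes in each row and each column and with $(i,j)\in D\Leftrightarrow(i+n,j+n)\in D$. $D$ is North-West (NW) if, whenever $(i,j)\in D$ and $(k,\ell)\in D$ with $i<k$ and $j>\ell$, also $(i,\ell)\in D$. A map $\mathcal{C}:D\to\mathbb{Z}$ is a content (map) if: (C1) if $b_1,b_2$ are in the same row (resp. column), $b_2$ to the east (resp. south) of $b_1$, with no boxes of $D$ between them, then $\mathcal{C}(b_2)-\mathcal{C}(b_1)=1$; (C2) if $b_2$ is strictly to the southeast of $b_1$ (strictly larger row index and strictly larger column index), then $\mathcal{C}(b_2)-\mathcal{C}(b_1)\ge2$; (C3) if $b_1=(i,j)$ and $b_2=(i+n,j+n)$, then $\mathcal{C}(b_2)-\mathcal{C}(b_1)=n$; (C4) for each row (resp. column) containing a box, the content of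 its leftmost (resp. topmost) box equals the row (resp. column) index. *)

(* Defs.v *)
From mathcomp Require Import all_boot all_order all_algebra.
From mathcomp Require Import all_classical.

Set Implicit Arguments.
Unset Strict Implicit.
Unset Printing Implicit Defensive.

Import Order.TTheory GRing.Theory Num.Theory.
Local Open Scope classical_set_scope.
Local Open Scope ring_scope.

(* A box (i, j) has row index i, increasing southward, and column index j,
   increasing eastward. *)

Definition affine_permutation (n : nat) (w : int -> int) : Prop :=
  [/\ bijective w,
      forall i : int, w (i + n%:Z) = w i + n%:Z
    & \sum_(1 <= i < n.+1) w i%:Z = ((n * n.+1)./2)%:Z].

Definition inversion_diagram (w : int -> int) : set (int * int) :=
  [set (p.1, w p.2) | p in [set p : int * int | p.1 < p.2 /\ w p.2 < w p.1]].

Definition affine_diagram (n : nat) (D : set (int * int)) : Prop :=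
  [/\ forall i : int, finite_set [set j | D (i, j)],
      forall j : int, finite_set [set i | D (i, j)]
    & forall i j : int, D (i, j) <-> D (i + n%:Z, j + n%:Z)].

Definition affine_permutation_diagram (n : nat) (D : set (int * int)) : Prop :=
  exists2 w : int -> int, affine_permutation n w & D = inversion_diagram w.

Definition north_west (D : set (int * int)) : Prop :=
  forall i j k l : int, D (i, j) -> D (k, l) -> i < k -> l < j -> D (i, l).

(* A map D -> int is represented by a total function on int * int, of which
   only the values on D are constrained. *)
Record content_map (n : nat) (D : set (int * int)) (C : int * int -> int)
    : Prop := ContentMap {
  content_row_step : forall i j l : int, D (i, j) -> D (i, l) -> j < l ->
    (forall m : int, j < m < l -> ~ D (i, m)) -> C (i, l) - C (i, j) = 1;
  content_col_step : forall i k j : int, D (i, j) -> D (k, j) -> i < k ->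
    (forall m : int, i < m < k -> ~ D (m, j)) -> C (k, j) - C (i, j) = 1;
  content_southeast : forall i j k l : int, D (i, j) -> D (k, l) ->
    i < k -> j < l -> 2 <= C (k, l) - C (i, j);
  content_period : forall i j : int, D (i, j) ->
    C (i + n%:Z, j + n%:Z) - C (i, j) = n%:Z;
  content_leftmost : forall i j : int, D (i, j) ->
    (forall m : int, D (i, m) -> j <= m) -> C (i, j) = i;
  content_topmost : forall i j : int, D (i, j) ->
    (forall m : int, D (m, j) -> i <= m) -> C (i, j) = j }.

(* Main.v *)
Require Import Defs.
From mathcomp Require Import all_boot all_order all_algebra.
From mathcomp Require Import all_classical.
From mathcomp Require Import zify.

(** Write B c i j for: (i, j) is a box of content c.

The forward direction rests on the rank function
F(i, p) = i + #{m >= i : w m < p} of an affine permutation w, with inverse v.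
It grows by [p <= w i] when i increases by 1, and by [i <= v p] when p does.
Hence it is constant between consecutive boxes of a row or column of D(w), and
gains 1 on passing each of them, which gives the adjacency condition; passing
a box in both directions gains 2, which gives the southeast condition.
Also F(i, p) = i for p very negative, whereas F(i, p) = p + kappa for i very
negative, with a constant kappa such that n * kappa is the sum of i - w i over
a period ([rank_exists]).  The normalization of w says exactly that kappa = 0,
and then the leftmost (topmost) box of each row (column) has the right content.
So F restricted to D(w) is a content map.

For the converse, the same picture shows how to read w off the contents.  Row i
carries the contents i, i+1, i+2, ... from west to east, up to some bound, and
columns do likewise; by the southeast condition the boxes of a given content c
form an antichain running from northeast to southwest.  The rows which reach
level c, that is, row c and the rows having a box of content c - 1, are as many
as the columns which do.  Matching them in opposite orders gives the
[staircase] of level c: its points are the corners lying just outside of the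
boxes of content c - 1, and all boxes of content c are among them
([box_on_staircase]).  The other points of the staircase, where a row and a
column stop together, are the [exit_point]s; there is exactly one in every row
and in every column, so they form the graph of a permutation w.  Boxes precede
the exit points of their row and their column, so D is contained in D(w); the
reverse inclusion is where the North-West condition enters
([exit_point_north_west]).  Finally w commutes with the shift by n since D and
its contents do; and C equals F along rows but F - kappa along columns, so
kappa = 0 as soon as there is a box, while w is the identity otherwise.

Hypotheses and constructions are kept symmetric under exchanging rows and
columns, so that each fact about rows also yields the one about columns. *)

Set Implicit Arguments.
Unset Strict Implicit.
Unset Printing Implicit Defensive.

Import Order.TTheory GRing.Theory Num.Theory.
Local Open Scope ring_scope.

(** * Integers *)

Lemma int_strong_ind (L : int) (P : int -> Prop) :
  (forall j, L <= j -> (forall k, L <= k -> k < j -> P k) -> P j) ->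
  forall j, L <= j -> P j.
Proof.
move=> step.
have H (s : nat) : forall j, L <= j -> j < L + s%:Z -> P j.
  elim: s => [|s IHs] j Lj js; first by lia.
  by apply: step => // k Lk kj; apply: IHs => //; lia.
by move=> j Lj; apply: (H `|j - L|.+1%N) => //; lia.
Qed.

Lemma int_min (P : int -> Prop) (L x : int) :
  P x -> (forall y, P y -> L <= y) ->
  exists2 m, P m & forall y, P y -> m <= y.
Proof.
move=> Px PL; have := PL _ Px; move: x Px.
suff H x : L <= x -> P x -> exists2 m, P m & forall y, P y -> m <= y.
  by move=> x Px Lx; apply: (H x).
move: x; apply: int_strong_ind => x Lx IH Px.
have [[y Py yx]|no] := pselect (exists2 y, P y & y < x).
  by apply: (IH y) => //; apply: PL.
exists x => // y Py; case: (leP x y) => // yx.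
by case: no; exists y.
Qed.

Lemma int_max (P : int -> Prop) (U x : int) :
  P x -> (forall y, P y -> y <= U) ->
  exists2 m, P m & forall y, P y -> y <= m.
Proof.
move=> Px PU.
have [||m Pm mP] := @int_min (fun y => P (- y)) (- U) (- x).
- by rewrite opprK.
- by move=> y /PU; lia.
exists (- m) => // y Py; have := mP (- y); rewrite opprK => /(_ Py); lia.
Qed.

Lemma int_step_const (f : int -> int) (a b : int) :
  a <= b -> (forall p, a <= p < b -> f (p + 1) = f p) -> f b = f a.
Proof.
move=> ab cst; move: b ab cst; apply: int_strong_ind => b ab IH cst.
have [->//|ne] := eqVneq b a.
rewrite -(IH (b - 1)); [|lia|lia|by move=> p pab; apply: cst; lia].
by rewrite -(cst (b - 1)) ?subrK //; lia.
Qed.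

Lemma int_step_le (f : int -> int) (a b : int) :
  a <= b -> (forall p, f p <= f (p + 1)) -> f a <= f b.
Proof.
move=> ab mono; move: b ab; apply: int_strong_ind => b ab IH.
have [->//|ne] := eqVneq b a.
apply: (le_trans (IH (b - 1) _ _)); [lia|lia|].
by have := mono (b - 1); rewrite subrK.
Qed.

Lemma int_finite_bounded (A : set int) :
  finite_set A -> exists L U : int, forall x, A x -> L <= x <= U.
Proof.
move=> /finite_seqP[s ->]; elim: s => [|y s [L [U LU]]]; first by exists 0, 0.
exists (Num.min L y), (Num.max U y) => x /=.
by rewrite inE => /orP[/eqP ->|/LU]; lia.
Qed.

(** * Staircases *)

Definition box_content (D : set (int * int)) (C : int * int -> int)
  (c i j : int) : Prop := D (i, j) /\ C (i, j) = c.

Definition transposed (B : int -> int -> int -> Prop) (c i j : int) : Prop :=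
  B c j i.

(** Only which contents occur in a row is recorded here; that they increase from
    west to east comes from the growth condition of [filling]. *)
Definition rows_filled (B : int -> int -> int -> Prop) : Prop :=
  [/\ forall c i j, B c i j -> i <= c,
      forall c c' i j, B c i j -> i <= c' <= c -> exists q, B c' i q
    & forall i, exists2 c, i <= c & forall q, ~ B c i q].

(** What the converse uses of a North-West diagram with contents.  The third
    condition merges strict growth along rows and columns with the southeast
    condition, the Boolean comparisons being read as 0 or 1; it also says that
    a position carries at most one content. *)
Definition filling (B : int -> int -> int -> Prop) : Prop :=
  [/\ rows_filled B, rows_filled (transposed B),
      forall c c' i j k l, B c i j -> B c' k l -> i <= k -> j <= l ->
        c + (i < k)%R%:Z + (j < l)%R%:Z <= c'
    & forall c c' i j k l, B c i j -> B c' k l -> i < k -> l < j ->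
        exists c'', B c'' i l].

Lemma filling_transposed B : filling B -> filling (transposed B).
Proof.
case=> rB cB mono nw; split => // [c c' i j k l Hij Hkl ik jl|].
  by have := mono _ _ _ _ _ _ Hij Hkl jl ik; lia.
by move=> c c' i j k l Hij Hkl ik lj; apply: (nw _ _ _ _ _ _ Hkl Hij lj ik).
Qed.

(** Position (i, p) belongs to the order-reversing matching of the rows reaching
    level c with the columns reaching it.  If the boxes of content c - 1 are
    (i_1, p_1), ..., (i_m, p_m) from northeast to southwest, the points are
    (i_1, c), (i_2, p_1), ..., (i_m, p_(m-1)), (c, p_m); the last clause
    expresses this without enumerating the boxes. *)
Definition staircase (B : int -> int -> int -> Prop) (c i p : int) : Prop :=
  [/\ i = c \/ exists q, B (c - 1) i q,
      p = c \/ exists k, B (c - 1) k p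
    & forall k l, B (c - 1) k l -> (k < i) = (p <= l)].

Lemma staircase_transposed B c i p :
  staircase B c i p -> staircase (transposed B) c p i.
Proof. by case=> Hi Hp sep; split=> // k l /sep; lia. Qed.

Lemma staircase_row_le B c i p : filling B -> staircase B c i p -> i <= c.
Proof. by case=> -[le _ _] _ _ _ [[->//|[q /le leq]] _ _]; lia. Qed.

Lemma staircase_col_le B c i p : filling B -> staircase B c i p -> p <= c.
Proof.
move=> /filling_transposed fB /staircase_transposed.
exact: staircase_row_le.
Qed.

(** Since i < k <= c, row i has a box of content c - 1; it separates the two
    points, lying weakly east of (k, l) and strictly west of (i, p). *)
Lemma staircase_antichain B c i p k l : filling B ->
  staircase B c i p -> staircase B c k l -> i < k -> l < p.
Proof.
move=> fB [[->|[q Bq]] _ sepi] sck ik.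
  by have := staircase_row_le fB sck; lia.
by case: sck => _ _ /(_ _ _ Bq); have := sepi _ _ Bq; lia.
Qed.

Lemma staircase_row_inj B c i p p' : filling B ->
  staircase B c i p -> staircase B c i p' -> p = p'.
Proof.
move=> /filling_transposed fB.
move=> /staircase_transposed H /staircase_transposed H'.
have [pp|pp|//] := ltgtP p p'.
  by have := staircase_antichain fB H H' pp; lia.
by have := staircase_antichain fB H' H pp; lia.
Qed.

Lemma staircase_col_inj B c i i' p : filling B ->
  staircase B c i p -> staircase B c i' p -> i = i'.
Proof.
move=> /filling_transposed fB /staircase_transposed H /staircase_transposed.
exact: staircase_row_inj H.
Qed.

Lemma row_enters_staircase B c i j : filling B -> B c i j ->
  i = c \/ exists q, B (c - 1) i q.
Proof.
case=> -[le down _] _ _ _ Hij; have [->|ne] := eqVneq i c; first by left.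
by right; apply: (down _ _ _ _ Hij); have := le _ _ _ Hij; lia.
Qed.

(** If the box (i, j) of content c and a box of content c - 1 violated the last
    clause of [staircase], then the latter would be strictly northwest of
    (i, j), against the southeast condition, or weakly southeast of it, against
    monotonicity. *)
Lemma box_on_staircase B c i j : filling B -> B c i j -> staircase B c i j.
Proof.
move=> fB Hij; split.
- exact: row_enters_staircase Hij.
- by apply: (row_enters_staircase (filling_transposed fB)); apply: Hij.
case: fB => _ _ mono _ k l Hkl.
have H1 := mono _ _ _ _ _ _ Hij Hkl; have H2 := mono _ _ _ _ _ _ Hkl Hij.
lia.
Qed.

(** The column sought is the one of the nearest box of content c - 1 above
    row i, or column c if there is none. *)
Lemma staircase_row_exists B c i : filling B ->
  (i = c \/ exists q, B (c - 1) i q) -> exists p, staircase B c i p.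
Proof.
move=> [_ [le _ _] mono _] Hi.
have [[k0 [l0 [k0i B0]]]|none] :=
    pselect (exists k l, k < i /\ B (c - 1) k l); last first.
  exists c; split=> //; first by left.
  move=> k l Hkl; have := le _ _ _ Hkl; case: (ltP k i) => [ki|]; last by lia.
  by case: none; exists k, l.
have [||k [ki [l Hkl]] kmax] :=
  @int_max (fun k => k < i /\ exists l, B (c - 1) k l) i k0.
- by split=> //; exists l0.
- by move=> y [yi _]; lia.
exists l; split=> //; first by right; exists k.
move=> k' l' B'.
have H1 := mono _ _ _ _ _ _ Hkl B'; have H2 := mono _ _ _ _ _ _ B' Hkl.
have H3 : k' < i -> k' <= k by move=> k'i; apply: kmax; split=> //; exists l'.
lia.
Qed.

(** Row i and column l have boxes of content c - 1, say (i, q) and (m, l) with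
    l <= q and i <= m; if neither is (i, l), the North-West condition applied
    to them gives the box (i, l). *)
Lemma staircase_north_west B c i j k l : filling B ->
  staircase B c i j -> staircase B c k l -> i < k -> exists c', B c' i l.
Proof.
move=> fB sij skl ik; have lj := staircase_antichain fB sij skl ik.
have kc := staircase_row_le fB skl; have jc := staircase_col_le fB sij.
case: sij skl => -[ic|[q Biq] _ sepi]; first by lia.
case=> _ [lc|[m Bml] sepk]; first by lia.
have := sepk _ _ Biq; have := sepi _ _ Bml; have := sepk _ _ Bml.
have [lq *|lq] := eqVneq l q; first by exists (c - 1); rewrite lq.
have [mi *|mi *] := eqVneq m i; first by exists (c - 1); rewrite -mi.
by case: fB => _ _ _ nw; apply: (nw _ _ _ _ _ _ Biq Bml); lia.
Qed.

(** * Exit points *)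

(** A point of a staircase where the row, hence also the column, has no further
    box.  For D(w) with its rank function these are the points (i, w i). *)
Definition exit_point (B : int -> int -> int -> Prop) (i p : int) : Prop :=
  exists2 c, staircase B c i p & forall q, ~ B c i q.

Lemma staircase_exits_together B c i p : filling B ->
  staircase B c i p -> (forall q, ~ B c i q) -> forall k, ~ B c k p.
Proof.
move=> fB sip noB k Bkp; apply: (noB p).
by rewrite (staircase_col_inj fB sip (box_on_staircase fB Bkp)).
Qed.

Lemma exit_point_transposed B i p : filling B ->
  exit_point B i p -> exit_point (transposed B) p i.
Proof.
move=> fB [c sip noB]; exists c; first exact: staircase_transposed.
exact: staircase_exits_together sip noB.
Qed.

Lemma exit_point_exists B i : filling B -> exists p, exit_point B i p.
Proof.
move=> fB; case: (fB) => -[le down fin] _ _ _.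
have [c0 ic0 no0] := fin i.
have [||c [ic noc] cmin] :=
  @int_min (fun c => i <= c /\ forall q, ~ B c i q) i c0.
- by [].
- by move=> y [].
have [|p sp] := @staircase_row_exists B c i fB.
  have [->|ne] := eqVneq i c; [by left|right].
  apply: contrapT => no; suff : c <= c - 1 by lia.
  apply: cmin; split=> [|q Bq]; first by lia.
  by apply: no; exists q.
by exists p; exists c.
Qed.

(** At a level before the last one, row i meets the staircase in its box of that
    content. *)
Lemma staircase_row_continues B c c' i p : filling B ->
  staircase B c i p -> i <= c' <= c -> exists p', staircase B c' i p'.
Proof.
move=> fB sip cc.
have [->|ne] := eqVneq c' c; first by exists p.
case: sip => -[ic|[q Biq] _ _]; first by lia.
case: (fB) => -[_ down _] _ _ _.
have [|p' B'] := down _ c' _ _ Biq; first by lia.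
by exists p'; apply: box_on_staircase.
Qed.

Lemma box_before_exit B c i j p : filling B ->
  B c i j -> exit_point B i p -> j < p.
Proof.
move=> fB Hij [c' [Hi Hp sep] noB].
case: (fB) => -[le down _] _ mono _.
have cc' : c < c'.
  case: (ltP c c') => // c'c.
  have [|q Bq] := down _ c' _ _ Hij; last by case: (noB q).
  by move: Hi => [|[q /le]]; lia.
case: Hi => [ic|[q Biq]]; first by have := le _ _ _ Hij; lia.
by have := mono _ _ _ _ _ _ Biq Hij; have := sep _ _ Biq; lia.
Qed.

(** Two exit points at levels c < c' are impossible: row i reaches level c', so
    it has a box of every content from i to c' - 1. *)
Lemma exit_point_inj B i p p' : filling B ->
  exit_point B i p -> exit_point B i p' -> p = p'.
Proof.
move=> fB [c sp noc] [c' sp' noc'].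
case: (fB) => -[le down _] _ _ _.
have aux d d' r r' : staircase B d i r -> (forall q, ~ B d i q) ->
    staircase B d' i r' -> ~ (d < d').
  move=> sr nod [Hi _ _] dd'; have := staircase_row_le fB sr.
  case: Hi => [->|[q Bq]] id; first by lia.
  have [|q' Bq'] := down _ d _ _ Bq; first by lia.
  exact: nod Bq'.
have := aux _ _ _ _ sp noc sp'; have := aux _ _ _ _ sp' noc' sp => n1 n2.
have cc' : c = c' by lia.
by move: sp'; rewrite -cc'; apply: staircase_row_inj.
Qed.

(** Moving west along row i to level c' reduces the claim to a single
    staircase. *)
Lemma staircases_north_west B c c' i j k l : filling B ->
  staircase B c i j -> staircase B c' k l -> c' <= c -> i < k ->
  exists c'', B c'' i l.
Proof.
move=> fB sij skl cc' ik; have kc' := staircase_row_le fB skl.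
have [|j' sij'] := staircase_row_continues (c' := c') fB sij; first by lia.
exact: (staircase_north_west fB sij' skl).
Qed.

(** Lower the level of whichever point has the higher one: (i, j) along its
    row, or (k, l) along its column. *)
Lemma exit_point_north_west B i j k l : filling B ->
  exit_point B i j -> exit_point B k l -> i < k -> l < j ->
  exists c, B c i l.
Proof.
move=> fB [c sij _] [c' skl _] ik lj.
have [c'c|cc'] := leP c' c; first exact: (staircases_north_west fB sij skl).
exact: (staircases_north_west (filling_transposed fB)
  (staircase_transposed skl) (staircase_transposed sij) (ltW cc') lj).
Qed.

(** * Contents along a row or column *)

Lemma line_ind (A : set int) (L : int) (P : int -> Prop) :
  (forall j, A j -> L <= j) ->
  (forall j, A j -> (forall m, A m -> j <= m) -> P j) ->
  (forall j l, A j -> A l -> j < l -> (forall m, j < m < l -> ~ A m) ->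
     P j -> P l) ->
  forall j, A j -> P j.
Proof.
move=> AL first next j Aj; have Lj := AL _ Aj; move: j Lj Aj.
apply: int_strong_ind => l Ll IH Al.
have [[k Ak kl]|no] := pselect (exists2 k, A k & k < l); last first.
  by apply: first => // m Am; case: (leP l m) => // ml; case: no; exists m.
have [//||j [Aj jl] jmax] := @int_max (fun k => A k /\ k < l) l k.
  by move=> y [_ /ltW].
apply: (next j) => //; last by apply: IH => //; apply: AL.
move=> m jml Am; have : m <= j by apply: jmax; split=> //; lia.
by lia.
Qed.

(** The content conditions that concern a single row (or column) of index i,
    whose boxes occupy the positions in A. *)
Definition line_content (A : set int) (i : int) (c : int -> int) : Prop :=
  (forall j l, A j -> A l -> j < l -> (forall m, j < m < l -> ~ A m) ->
     c l - c j = 1) /\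
  (forall j, A j -> (forall m, A m -> j <= m) -> c j = i).

Lemma line_content_increasing A i c j l : finite_set A -> line_content A i c ->
  A j -> A l -> j < l -> c j < c l.
Proof.
move=> /int_finite_bounded[L [U LU]] [step _] + Al; move: l Al j.
apply: (@line_ind A L)
  => [j /LU/andP[]//|l Al lmin j Aj|k l Ak Al kl no IH j Aj] jl.
  by have := lmin _ Aj; lia.
have := step _ _ Ak Al kl no; have [->|jk] := eqVneq j k; first by lia.
have := IH _ Aj; case: (ltP j k) => [_ /(_ isT)|kj]; first by lia.
by case: (no j) => //; lia.
Qed.

Lemma line_content_interval A i c : finite_set A -> line_content A i c ->
  forall j, A j ->
  i <= c j /\ forall c', i <= c' <= c j -> exists q, A q /\ c q = c'.
Proof.
move=> /int_finite_bounded[L [U LU]] [step first].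
apply: (@line_ind A L) => [j /LU/andP[]//|j Aj jmin|j l Aj Al jl no [ij IH]].
  have cj := first _ Aj jmin; split=> [|c' ic']; first by lia.
  by exists j; split=> //; lia.
have cl := step _ _ Aj Al jl no; split=> [|c' ic']; first by lia.
have [->|ne] := eqVneq c' (c l); first by exists l.
by apply: IH; lia.
Qed.

Lemma line_content_ends (A : set int) (i : int) (c : int -> int) :
  finite_set A ->
  exists2 c', i <= c' & forall q, ~ (A q /\ c q = c').
Proof.
move=> fA; have [L [U LU]] := int_finite_bounded (finite_image c fA).
exists (Num.max i U + 1) => [|q [Aq cq]]; first by lia.
have : L <= c q <= U by apply: LU; exists q.
lia.
Qed.

Lemma content_map_rows n D C : content_map n D C ->
  forall i, line_content [set j | D (i, j)] i (fun j => C (i, j)).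
Proof.
by case=> step _ _ _ first _ i; split=> [j l|j]; [exact: step|exact: first].
Qed.

Lemma content_map_columns n D C : content_map n D C ->
  forall j, line_content [set i | D (i, j)] j (fun i => C (i, j)).
Proof.
by case=> _ step _ _ _ first j; split=> [i k|i]; [exact: step|exact: first].
Qed.

Lemma content_filling n D C : affine_diagram n D -> north_west D ->
  content_map n D C -> filling (box_content D C).
Proof.
move=> [finr finc _] nw mapC.
have rowC := content_map_rows mapC; have colC := content_map_columns mapC.
split.
- split=> [c i j [Dij <-]|c c' i j [Dij <-]|i].
  + by have [] := line_content_interval (finr i) (rowC i) Dij.
  + by have [_] := line_content_interval (finr i) (rowC i) Dij; apply.
  + exact: line_content_ends (finr i).
- split=> [c j i [Dij <-]|c c' j i [Dij <-]|j].
  + by have [] := line_content_interval (finc j) (colC j) Dij.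
  + by have [_] := line_content_interval (finc j) (colC j) Dij; apply.
  + exact: (@line_content_ends _ _ (fun i => C (i, j)) (finc j)).
- move=> c c' i j k l [Dij <-] [Dkl <-].
  rewrite le_eqVlt => /orP[/eqP ik|ik]; rewrite le_eqVlt => /orP[/eqP jl|jl].
  + by rewrite -ik -jl; lia.
  + rewrite -ik in Dkl *.
    by have := line_content_increasing (finr i) (rowC i) Dij Dkl jl; lia.
  + rewrite -jl in Dkl *.
    by have := line_content_increasing (finc j) (colC j) Dij Dkl ik; lia.
  + by have := content_southeast mapC Dij Dkl ik jl; lia.
- move=> c c' i j k l [Dij _] [Dkl _] ik lj; exists (C (i, l)).
  by split=> //; apply: nw Dij Dkl ik lj.
Qed.

(** * The rank function of a permutation *)

(** The conditions on the rank function of the permutation with inverse v that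
    govern its restriction to a row; those governing columns are the same
    conditions for the transpose of F and the inverse permutation. *)
Definition row_ranked (v : int -> int) (F : int -> int -> int) : Prop :=
  (forall i p, F i (p + 1) = F i p + (i <= v p)%R%:Z) /\
  (forall i, exists P, forall p, p <= P -> F i p = i).

Definition inversion_row (w v : int -> int) (i : int) : set int :=
  [set p | i < v p /\ p < w i].

(** A position p < w i which is not a box of row i has v p < i, so F i does not
    change from p to p + 1. *)
Lemma ranked_line_content w v F i : cancel v w -> row_ranked v F ->
  line_content (inversion_row w v i) i (F i).
Proof.
move=> vK [step lim]; split=> [j l [ivj jwi] [ivl lwi] jl no|j [ivj jwi] jmin].
  have -> : F i l = F i (j + 1).
    apply: int_step_const => [|p jpl]; first by lia.
    have vpi : v p <> i by move=> vpi; have := vK p; rewrite vpi; lia.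
    have := no p; rewrite /inversion_row /= => {}no.
    rewrite step; case: (leP i (v p)) => [ivp|]; last by lia.
    by case: no; lia.
  by rewrite step; lia.
have [P limP] := lim i; have [jP|Pj] := leP j P; first exact: limP.
apply: (eq_trans _ (limP P _)) => //.
apply: int_step_const => [|p pj]; first by lia.
have vpi : v p <> i by move=> vpi; have := vK p; rewrite vpi; lia.
rewrite step; case: (leP i (v p)) => [ivp|]; last by lia.
have : j <= p by apply: jmin; split; lia.
lia.
Qed.

Lemma ranked_line_content_unique w v F i c : cancel v w -> row_ranked v F ->
  line_content (inversion_row w v i) i c ->
  forall j, inversion_row w v i j -> c j = F i j.
Proof.
move=> vK rF [cstep cfirst]; have [Fstep Ffirst] := ranked_line_content i vK rF.
case: rF => step lim; have [P limP] := lim i.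
apply: (@line_ind _ P) => [j [ij _]|j Aj jmin|j l Aj Al jl no cj].
- case: (leP P j) => // jP.
  by have := step i j; rewrite !limP; lia.
- by rewrite cfirst ?Ffirst.
- by have := cstep _ _ Aj Al jl no; have := Fstep _ _ Aj Al jl no; lia.
Qed.

Definition affine_map (n : nat) (w : int -> int) : Prop :=
  forall i : int, w (i + n%:Z) = w i + n%:Z.

Lemma periodic_bounded (n : nat) (g : int -> int) : (0 < n)%N ->
  (forall m : int, g (m + n%:Z) = g m) ->
  exists M : nat, forall m : int, - M%:Z < g m < M%:Z.
Proof.
move=> n0 per.
have perk (k : nat) (m : int) : g (m + k%:Z * n%:Z) = g m.
  elim: k => [|k IH]; first by rewrite mul0r addr0.
  by rewrite -IH -[RHS]per; congr g; lia.
have [M boundM] : exists M : nat,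
    forall r : nat, (r < n)%N -> - M%:Z < g r < M%:Z.
  elim: n {n0 per perk} => [|n [M IH]]; first by exists 0%N.
  exists (M + `|g n|.+1)%N => r.
  by rewrite ltnS leq_eqVlt => /orP[/eqP ->|/IH]; lia.
exists M => m.
have -> : g m = g (m %% n%:Z)%Z; last first.
  have r0 : (0 <= m %% n%:Z)%Z by apply: modz_ge0; lia.
  have rn : ((m %% n%:Z)%Z < n%:Z) by apply: ltz_pmod; lia.
  by have := boundM `|(m %% n%:Z)%Z|%N; rewrite gez0_abs //; apply; lia.
rewrite [in LHS](divz_eq m n%:Z) addrC; case: (m %/ n%:Z)%Z => k.
  by rewrite perk.
by rewrite -[LHS](perk k.+1); congr g; lia.
Qed.

(** Shifting the window by 1 drops the term at 1 and adds the equal term at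
    n + 1. *)
Lemma sum_periodic_shift (n : nat) (g : int -> int) (s : int) :
  (forall m : int, g (m + n%:Z) = g m) ->
  \sum_(1 <= i < n.+1) g (i%:Z + s) = \sum_(1 <= i < n.+1) g i%:Z.
Proof.
move=> per.
have shift1 (t : int) : \sum_(1 <= i < n.+1) g (i%:Z + (t + 1)) =
                \sum_(1 <= i < n.+1) g (i%:Z + t).
  apply/eqP; rewrite -subr_eq0 -sumrB.
  rewrite (eq_bigr (fun i : nat => g (i.+1%:Z + t) - g (i%:Z + t))); last first.
    by move=> i _; congr (g _ - _); lia.
  rewrite (@telescope_sumr _ 1 n.+1 (fun i : nat => g (i%:Z + t))) //.
  rewrite subr_eq0; apply/eqP; rewrite -(per (1%:Z + t)); congr g; lia.
have up (k : nat) (t : int) : \sum_(1 <= i < n.+1) g (i%:Z + (t + k%:Z)) =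
                \sum_(1 <= i < n.+1) g (i%:Z + t).
  elim: k => [|k IH]; first by rewrite addr0.
  by rewrite -IH -[RHS]shift1; apply: eq_bigr => i _; congr g; lia.
transitivity (\sum_(1 <= i < n.+1) g (i%:Z + 0)).
  case: s => k; first by rewrite -(up k 0); apply: eq_bigr => i _; congr g; lia.
  by rewrite -(up k.+1); apply: eq_bigr => i _; congr g; lia.
by apply: eq_bigr => i _; rewrite addr0.
Qed.

Lemma sum_first_naturals (n : nat) :
  \sum_(1 <= i < n.+1) i%:Z = ((n * n.+1)./2)%:Z.
Proof.
elim: n => [|n IH]; first by rewrite big_geq.
have -> : (n.+1 * n.+2 = n * n.+1 + n.+1.*2)%N by lia.
by rewrite big_nat_recr //= IH halfD odd_double andbF add0n doubleK; lia.
Qed.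

Lemma sum_indicator_eq (T : nat) (x : int) :
  \sum_(t < T) (t%:Z == x)%:Z = (0 <= x < T%:Z)%R%:Z.
Proof.
elim: T => [|T IH]; first by rewrite big_ord0; lia.
by rewrite big_ord_recr /= IH; lia.
Qed.

Lemma sum_indicator_lt (T : nat) (x : int) : 0 <= x <= T%:Z ->
  \sum_(t < T) (t%:Z < x)%R%:Z = x.
Proof.
move=> xT; have -> : x = Num.min x T%:Z by lia.
have {xT} : 0 <= x by lia.
elim: T => [|T IH] x0; first by rewrite big_ord0; lia.
have := IH x0; rewrite big_ord_recr /= => H.
rewrite -[RHS](_ : Num.min x T%:Z + (T%:Z < x)%R%:Z = _); last by lia.
rewrite -[in RHS]H; congr (_ + _); last by lia.
by apply: eq_bigr => t _; have := ltn_ord t; lia.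
Qed.

(** A finite truncation of #{m >= i : w m < p}; since w m - m is bounded, it is
    exact as soon as T is large ([rank_window_stable]). *)
Definition rank_window (w : int -> int) (T : nat) (i p : int) : int :=
  \sum_(t < T) (w (i + t%:Z) < p)%R%:Z.

Lemma rank_window_stable w (M T T' : nat) (i p : int) :
  (forall m : int, m - M%:Z < w m) -> p + M%:Z - i <= T%:Z -> (T <= T')%N ->
  rank_window w T' i p = rank_window w T i p.
Proof.
move=> wM pT TT'; rewrite -(subnKC TT'); elim: (T' - T)%N => [|s IH].
  by rewrite addn0.
rewrite addnS -{}IH /rank_window big_ord_recr /=.
have -> : (w (i + (T + s)%:Z) < p) = false by have := wM (i + (T + s)%:Z); lia.
by rewrite addr0.
Qed.

(** Write M for a bound on |w m - m|.  The step rules are immediate from the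
    definition of F as a count, and F(i, p) = i for p <= i - M.  By the step
    rules F(p - M, p) - p does not depend on p; this is kappa, and F(i, p)
    remains equal to p + kappa for smaller i.  To evaluate kappa, sum
    F(p - M, p) over a period: after exchanging summations and using that
    w m - m is periodic, each m contributes the number of t < 2M such that
    t < M + (m - w m), which is M + (m - w m). *)
Lemma rank_exists (n : nat) (w v : int -> int) : (0 < n)%N ->
  cancel w v -> cancel v w -> affine_map n w ->
  exists F : int -> int -> int, exists kappa : int,
    [/\ row_ranked v F, row_ranked w (fun p i => F i p - kappa),
        forall i p, F (i + n%:Z) (p + n%:Z) = F i p + n%:Z
      & n%:Z * kappa = \sum_(1 <= i < n.+1) (i%:Z - w i%:Z)].
Proof.
move=> n0 wK vK aw.
have [M dM] : exists M : nat, forall m : int, - M%:Z < w m - m < M%:Z.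
  by apply: (@periodic_bounded n) => // m; rewrite aw; lia.
have wM (m : int) : m - M%:Z < w m by have := dM m; lia.
have vM (p : int) : p - M%:Z < v p < p + M%:Z.
  by have := dM (v p); rewrite vK; lia.
pose width (i p : int) := `|(p + M%:Z - i)%R|%N.
pose F (i p : int) := i + rank_window w (width i p) i p.
have FE (T : nat) (i p : int) : p + M%:Z - i <= T%:Z ->
    F i p = i + rank_window w T i p.
  move=> pT; congr (_ + _); case: (leqP (width i p) T) => TT.
    by rewrite (rank_window_stable (T := width i p) wM) //; rewrite /width; lia.
  by rewrite -(rank_window_stable wM pT (ltnW TT)).
(* Exactly one term changes, that of m = v p, provided that v p >= i. *)
have colstep (i p : int) : F i (p + 1) = F i p + (i <= v p)%R%:Z.
  have T1 : p + 1 + M%:Z - i <= (width i p).+1%:Z by rewrite /width; lia.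
  rewrite (FE _ _ _ T1) (FE (width i p).+1); last by lia.
  rewrite -addrA; congr (_ + _); apply/eqP.
  rewrite addrC -subr_eq -sumrB; apply/eqP.
  rewrite (eq_bigr (fun t : 'I__ => (t%:Z == v p - i)%:Z)).
    by rewrite sum_indicator_eq; have := vM p; lia.
  move=> t _; have [tv|tv] := eqVneq (i + t%:Z) (v p).
    by rewrite tv vK; lia.
  have : w (i + t%:Z) <> p by move=> /(congr1 v); rewrite wK; apply/eqP.
  by lia.
(* Dropping m = i from the count loses [w i < p], while i gains 1. *)
have rowstep (i p : int) : F (i + 1) p = F i p + (p <= w i)%R%:Z.
  have window : rank_window w (width i p).+1 i p =
      (w i < p)%R%:Z + rank_window w (width i p) (i + 1) p.
    rewrite /rank_window big_ord_recl /= addr0; congr (_ + _).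
    apply: eq_bigr => t _; congr (_%:Z); congr (nat_of_bool (w _ < _)).
    by rewrite /bump; lia.
  rewrite (FE (width i p)) ?(FE (width i p).+1 i); try (rewrite /width; lia).
  by rewrite window; lia.
have Fleft (i p : int) : p <= i - M%:Z -> F i p = i.
  move=> piM; rewrite (FE 0%N); last by lia.
  by rewrite /rank_window big_ord0 addr0.
have [kappa Fdiag] : exists kappa, forall p : int, F (p - M%:Z) p = p + kappa.
  exists (F (0 - M%:Z) 0 - 0) => p.
  suff <- : F (p - M%:Z) p - p = F (0 - M%:Z) 0 - 0 by rewrite [RHS]addrC subrK.
  have diag (q : int) : F (q + 1 - M%:Z) (q + 1) - (q + 1) = F (q - M%:Z) q - q.
    rewrite (_ : q + 1 - M%:Z = q - M%:Z + 1); last by lia.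
    by rewrite colstep rowstep; have := dM (q - M%:Z); have := vM q; lia.
  have [p0|p0] := leP 0 p.
    by apply: (@int_step_const (fun q => F (q - M%:Z) q - q)).
  by apply/esym/(@int_step_const (fun q => F (q - M%:Z) q - q)) => //; lia.
have Ftop (i p : int) : i <= p - M%:Z -> F i p = p + kappa.
  move=> ip; rewrite -Fdiag; apply/esym.
  apply: (@int_step_const (F^~ p)) => // m mip.
  by rewrite rowstep; have := dM m; lia.
exists F, kappa; split.
- by split=> // i; exists (i - M%:Z); apply: Fleft.
- split=> [p i|p]; first by rewrite rowstep; lia.
  by exists (p - M%:Z) => i /Ftop ->; rewrite addrK.
- move=> i p; rewrite /F (_ : width (i + n%:Z) _ = width i p); last first.
    by rewrite /width; lia.
  rewrite addrAC; congr (_ + _ + _); apply: eq_bigr => t _.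
  by rewrite addrAC aw ltrD2r.
have : \sum_(1 <= p < n.+1) (M%:Z + kappa) =
       \sum_(1 <= p < n.+1) (M%:Z + (p%:Z - w p%:Z)).
  transitivity (\sum_(1 <= p < n.+1) rank_window w (2 * M) (p%:Z - M%:Z) p%:Z).
    apply: eq_bigr => p _; have := Fdiag p%:Z.
    by rewrite (FE (2 * M)%N); lia.
  rewrite exchange_big /=.
  pose g (t : nat) (m : int) : int := (t%:Z < M%:Z + (m - w m))%R%:Z.
  transitivity (\sum_(t < 2 * M) \sum_(1 <= p < n.+1) g t p%:Z).
    apply: eq_bigr => t _.
    rewrite -(@sum_periodic_shift n (g t) (t%:Z - M%:Z)).
      apply: eq_bigr => p _.
      rewrite /g (_ : p%:Z + (t%:Z - M%:Z) = p%:Z - M%:Z + t%:Z); last by lia.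
      by congr (nat_of_bool _)%:Z; lia.
    by move=> m; rewrite /g aw; congr (_%:Z); lia.
  rewrite exchange_big /=; apply: eq_bigr => p _.
  by apply: sum_indicator_lt; have := dM p%:Z; lia.
rewrite !big_split /= => /addrI <-.
by rewrite sumr_const_nat subn1 /= -mulr_natl natz.
Qed.

(** * Permutation diagrams have contents *)

Lemma inversion_diagramE w v i p : cancel w v -> cancel v w ->
  inversion_diagram w (i, p) <-> i < v p /\ p < w i.
Proof.
move=> wK vK; split=> [[[a b] /= [ab wba] [<- <-]]|[ivp pwi]].
  by rewrite wK.
by exists (i, v p) => /=; rewrite vK.
Qed.

(** The rank function is a content map; the normalization of w enters only in
    kappa = 0, which makes columns start at the right content. *)
Lemma inversion_diagram_content_map n w v : cancel w v -> cancel v w ->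
  affine_map n w -> \sum_(1 <= i < n.+1) w i%:Z = ((n * n.+1)./2)%:Z ->
  (0 < n)%N ->
  exists C, content_map n (inversion_diagram w) C.
Proof.
move=> wK vK aw sumw n0.
have [F [kappa [rowF colF perF sumF]]] := rank_exists n0 wK vK aw.
have kappa0 : kappa = 0.
  move: sumF; rewrite sumrB sum_first_naturals sumw subrr => /eqP.
  by rewrite mulf_eq0 => /orP[|] /eqP; lia.
have {}colF : row_ranked w (fun p i => F i p).
  move: colF; rewrite kappa0.
  by under eq_fun do under eq_fun do rewrite subr0.
have E i p := inversion_diagramE i p wK vK.
have lineR i : line_content (inversion_row w v i) i (F i) :=
  ranked_line_content i vK rowF.
have lineC p : line_content (inversion_row v w p) p (F^~ p) :=
  ranked_line_content p wK colF.
exists (fun b => F b.1 b.2); split=> /=.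
- move=> i j l /E Dij /E Dil jl no; case: (lineR i) => step _.
  by apply: step => // m /no noD Dm; apply: noD; apply/E.
- move=> i k j /E[ij ji] /E[kj jk] ik no; case: (lineC j) => step _.
  by apply: step => // m /no noD [Dm mD]; apply: noD; apply/E.
- move=> i j k l /E[ij ji] _ ik jl.
  have [stepR _] := rowF; have [stepC _] := colF.
  (* At a box the rank grows by 2 from (i, j) to (i + 1, j + 1). *)
  have H1 : F (i + 1) (j + 1) <= F k (j + 1).
    apply: (@int_step_le (F^~ (j + 1))) => [|m]; first by lia.
    by rewrite stepC; lia.
  have H2 : F k (j + 1) <= F k l.
    by apply: int_step_le => [|m]; [lia|rewrite stepR; lia].
  by move: H1; rewrite stepR stepC; lia.
- by move=> i j _; rewrite perF; lia.
- move=> i j /E Dij jmin; case: (lineR i) => _; apply=> // m Dm.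
  by apply/jmin/E.
- move=> i j /E[ij ji] imin; case: (lineC j) => _; apply=> // m [Dm mD].
  by apply/imin/E.
Qed.

Lemma inversion_diagram_north_west w : bijective w ->
  north_west (inversion_diagram w).
Proof.
case=> v wK vK i j k l /(inversion_diagramE _ _ wK vK)[ij ji].
move=> /(inversion_diagramE _ _ wK vK)[kl lk] ik lj.
by apply/(inversion_diagramE _ _ wK vK); lia.
Qed.

(** * From contents to an affine permutation *)

Lemma exit_point_shift B (s i p : int) :
  (forall c i j, B c i j <-> B (c + s) (i + s) (j + s)) ->
  exit_point B i p -> exit_point B (i + s) (p + s).
Proof.
move=> per.
have per' c i' j : B c i' j -> B (c - s) (i' - s) (j - s).
  by move=> H; apply/per; rewrite !subrK.
have pred c : c + s - 1 = c - 1 + s by lia.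
move=> [c [Hi Hp sep] noB]; exists (c + s); last first.
  by move=> q /per'; rewrite !addrK; apply: noB.
split.
- case: Hi => [->|[q Bq]]; [by left|right].
  by exists (q + s); rewrite pred; apply: (per _ _ _).1.
- case: Hp => [->|[k Bk]]; [by left|right].
  by exists (k + s); rewrite pred; apply: (per _ _ _).1.
- move=> k l; rewrite pred => /per'; rewrite addrK => /sep; lia.
Qed.

Lemma exit_permutation B : filling B -> exists w v : int -> int,
  [/\ cancel w v, cancel v w, forall i, exit_point B i (w i)
    & forall i p, i < v p /\ p < w i <-> exists c, B c i p].
Proof.
move=> fB; have fT := filling_transposed fB.
have [w exitw] := choice (fun i => exit_point_exists i fB).
have [v exitv] := choice (fun p => exit_point_exists p fT).
have wK : cancel w v.
  by move=> i; apply: (exit_point_inj fT (exitv _));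
    apply: exit_point_transposed.
have vK : cancel v w.
  move=> p; apply: (exit_point_inj fB (exitw _)).
  exact: (exit_point_transposed fT (exitv p)).
exists w, v; split=> // i p; split=> [[ivp pwi]|[c Hip]].
  have := exit_point_north_west fB (exitw i) (exitw (v p)) ivp.
  by rewrite vK; apply.
by split; [apply: (box_before_exit fT _ (exitv p)); apply: Hip
          |apply: (box_before_exit fB Hip)].
Qed.

(** The exit permutation is normalized because contents are computed by F along
    rows and by F - kappa along columns. *)
Lemma content_map_affine_permutation n D C : (0 < n)%N ->
  affine_diagram n D -> north_west D -> content_map n D C ->
  affine_permutation_diagram n D.
Proof.
move=> n0 aD nw mapC; have fB := content_filling aD nw mapC.
have [w [v [wK vK exitw DE]]] := exit_permutation fB.
have {}DE i p : D (i, p) <-> i < v p /\ p < w i.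
  by split=> [Dip|/DE[c []]//]; apply/DE; exists (C (i, p)).
have aw : affine_map n w.
  move=> i; apply: (exit_point_inj fB (exitw _)); apply: exit_point_shift => //.
  case: aD => _ _ perD c k l; split=> [[Dkl Ckl]|[Dkl Ckl]].
    split; first exact: (perD _ _).1.
    by apply/eqP; rewrite -Ckl [eqbRHS]addrC -subr_eq (content_period mapC Dkl).
  have D' : D (k, l) by apply: (perD _ _).2.
  split=> //; apply: (addIr n%:Z); rewrite -Ckl.
  by apply/esym/eqP; rewrite [eqbRHS]addrC -subr_eq (content_period mapC D').
exists w; last first.
  by apply/seteqP; split=> -[i p] /=; rewrite DE (inversion_diagramE _ _ wK vK).
split=> //; first by exists v.
have [F [kappa [rowF colF _ sumF]]] := rank_exists n0 wK vK aw.
(* It remains to see that the constant kappa of the rank function is 0. *)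
suff : \sum_(1 <= i < n.+1) (i%:Z - w i%:Z) = 0.
  by rewrite sumrB sum_first_naturals => /eqP; rewrite subr_eq0 => /eqP.
(* Without boxes, the staircase of level c is the single point (c, c). *)
have [[i [j Dij]]|none] := pselect (exists i j, D (i, j)); last first.
  apply: big1 => i _; case: (exitw i%:Z) => c [Hi Hp _] _.
  case: Hi => [ic|[q [Dq _]]]; last first.
    by case: none; exists i%:Z, q.
  case: Hp => [wc|[k [Dk _]]]; first by rewrite wc -ic subrr.
  by case: none; exists k, (w i%:Z).
have [ij ji] : i < v j /\ j < w i by apply/DE.
have rowset k : inversion_row w v k = [set l : int | D (k, l)]%classic.
  by apply/seteqP; split=> l /=; rewrite DE.
have colset l : inversion_row v w l = [set k : int | D (k, l)]%classic.
  by apply/seteqP; split=> k /=; rewrite DE => -[].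
have CF : C (i, j) = F i j.
  apply: (ranked_line_content_unique vK rowF (i := i) (c := fun j => C (i, j))).
    by rewrite rowset; apply: content_map_rows mapC _.
  by [].
have CF' : C (i, j) = F i j - kappa.
  apply: (ranked_line_content_unique wK colF (i := j) (c := fun i => C (i, j))).
    by rewrite colset; apply: content_map_columns mapC _.
  by [].
by rewrite -sumF (_ : kappa = 0) ?mulr0 //; lia.
Qed.

Theorem theorem4p5 (n : nat) (hn : (1 <= n)%N) (D : set (int * int))
    (hD : affine_diagram n D) :
  affine_permutation_diagram n D <->
  (north_west D /\ exists C : int * int -> int, content_map n D C).
Proof.
split=> [[w [bw aw sumw] ->]|[nw [C mapC]]].
  split; first exact: inversion_diagram_north_west.
  have [v wK vK] := bw.
  exact: (inversion_diagram_content_map wK vK aw sumw hn).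
exact: content_map_affine_permutation hn hD nw mapC.
Qed.
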